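(* There is no injective unital $*$-homomorphism of $\mathbb{Z}$-algebras from $L_{2,\mathbb{Z}}\otimes_{\mathbb{Z}} L_{2,\mathbb{Z}}$ into $L_{2,\mathbb{Z}}$.
   Context: $L_{2,\mathbb{Z}}$ denotes the universal unital $\mathbb{Z}$-algebra (ring) generated by elements $a,a^*,b,b^*$ subject to $a^*a=b^*b=1=aa^*+bb^*$. For a finite word $\alpha=\alpha_1\cdots\alpha_n$ in $a,b$ (the empty word is interpreted as $1$) put $\alpha^*=\alpha_n^*\cdots\alpha_1^*$. Every element of $L_{2,\mathbb{Z}}$ is a finite $\mathbb{Z}$-linear combination of elements $\alpha\beta^*$ with $\alpha,\beta$ words in $a,b$, and $\alpha\beta^*\mapsto\beta\alpha^*$ extends to a $\mathbb{Z}$-linear involution $*$ on $L_{2,\mathbb{Z}}$. The tensor product $L_{2,\mathbb{Z}}\otimes_{\mathbb{Z}} L_{2,\mathbb{Z}}$ is an involutive $\mathbb{Z}$-algebra with $(x\otimes y)^*=x^*\otimes y^*$. A $*$-homomorphism is an algebra homomorphism preserving the involution. *)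

(* Defs.v *)
From HB Require Import structures.
From mathcomp Require Import all_boot all_algebra.
From mathcomp Require Import boolp.

Set Implicit Arguments.
Unset Strict Implicit.
Unset Printing Implicit Defensive.

Import GRing.Theory.
Local Open Scope ring_scope.
Local Open Scope quotient_scope.

(* Rings are taken in [pzRingType] (0 = 1 is not excluded a priori), so that  *)
(* no nontriviality has to be decided in order to define the objects below.   *)
(* A Z-algebra is a ring, and a unital Z-algebra homomorphism is an           *)
(* [{rmorphism _ -> _}].                                                      *)

HB.mixin Record hasStar R of GRing.PzRing R := {
  star : R -> R;
  starD : {morph star : x y / x + y};
  starM : forall x y, star (x * y) = star y * star x;
  starK : involutive star
}.

#[short(type="starRingType")]
HB.structure Definition StarRing := {R of GRing.PzRing R & hasStar R}.

Definition star_preserving (R S : starRingType) (f : R -> S) : Prop :=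
  {morph f : x / star x}.

Lemma star1 (R : starRingType) : star (1 : R) = 1.
Proof. by rewrite -[LHS]mulr1 -{2}[1](@starK R) -starM mulr1 starK. Qed.

Section Leavitt.

Inductive leavitt_term : Type :=
| LA | LAs | LB | LBs
| LZero | LOne
| LOpp of leavitt_term
| LAdd of leavitt_term & leavitt_term
| LMul of leavitt_term & leavitt_term.

HB.instance Definition _ := gen_eqMixin leavitt_term.
HB.instance Definition _ := gen_choiceMixin leavitt_term.

(* The ring congruence generated by a^* a = b^* b = 1 = a a^* + b b^*; its    *)
(* quotient [leavitt2] is L_{2,Z}.                                            *)
Inductive leavitt_cong : leavitt_term -> leavitt_term -> Prop :=
| lc_refl s : leavitt_cong s s
| lc_sym s t : leavitt_cong s t -> leavitt_cong t s
| lc_trans s t u : leavitt_cong s t -> leavitt_cong t u -> leavitt_cong s u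
| lc_opp s s' : leavitt_cong s s' -> leavitt_cong (LOpp s) (LOpp s')
| lc_add s s' t t' : leavitt_cong s s' -> leavitt_cong t t' ->
    leavitt_cong (LAdd s t) (LAdd s' t')
| lc_mul s s' t t' : leavitt_cong s s' -> leavitt_cong t t' ->
    leavitt_cong (LMul s t) (LMul s' t')
| lc_addA s t u : leavitt_cong (LAdd s (LAdd t u)) (LAdd (LAdd s t) u)
| lc_addC s t : leavitt_cong (LAdd s t) (LAdd t s)
| lc_add0 s : leavitt_cong (LAdd LZero s) s
| lc_addN s : leavitt_cong (LAdd (LOpp s) s) LZero
| lc_mulA s t u : leavitt_cong (LMul s (LMul t u)) (LMul (LMul s t) u)
| lc_mul1l s : leavitt_cong (LMul LOne s) s
| lc_mul1r s : leavitt_cong (LMul s LOne) s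
| lc_mulDl s t u :
    leavitt_cong (LMul (LAdd s t) u) (LAdd (LMul s u) (LMul t u))
| lc_mulDr s t u :
    leavitt_cong (LMul s (LAdd t u)) (LAdd (LMul s t) (LMul s u))
| lc_aa : leavitt_cong (LMul LAs LA) LOne
| lc_bb : leavitt_cong (LMul LBs LB) LOne
| lc_ab : leavitt_cong (LAdd (LMul LA LAs) (LMul LB LBs)) LOne.

Definition leavitt_rel : rel leavitt_term := fun s t => `[< leavitt_cong s t >].

Lemma leavitt_rel_refl : reflexive leavitt_rel.
Proof. by move=> s; apply/asboolP; apply: lc_refl. Qed.

Lemma leavitt_rel_sym : symmetric leavitt_rel.
Proof. by move=> s t; apply/asboolP/asboolP; apply: lc_sym. Qed.

Lemma leavitt_rel_trans : transitive leavitt_rel.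
Proof.
by move=> t s u /asboolP st /asboolP tu; apply/asboolP; apply: lc_trans st tu.
Qed.

Canonical leavitt_equiv : equiv_rel leavitt_term :=
  EquivRel leavitt_rel leavitt_rel_refl leavitt_rel_sym leavitt_rel_trans.

Definition leavitt2 : Type := {eq_quot leavitt_equiv}.

HB.instance Definition _ := Choice.on leavitt2.
HB.instance Definition _ := EqQuotient.on leavitt2.

Definition leavitt_pi (s : leavitt_term) : leavitt2 := \pi_leavitt2 s.

Lemma leavitt_piP s t : leavitt_pi s = leavitt_pi t <-> leavitt_cong s t.
Proof.
by split=> [/eqquotP/asboolP//|st]; apply/eqquotP/asboolP.
Qed.

Lemma leavitt_repr s : leavitt_cong (repr (leavitt_pi s)) s.
Proof. by apply/leavitt_piP; rewrite /leavitt_pi reprK. Qed.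

Lemma leavitt_ind (P : leavitt2 -> Prop) :
  (forall s, P (leavitt_pi s)) -> forall u, P u.
Proof. by move=> Ps u; rewrite -[u]reprK; apply: Ps. Qed.

Definition leavitt_opp (u : leavitt2) := leavitt_pi (LOpp (repr u)).
Definition leavitt_add (u v : leavitt2) := leavitt_pi (LAdd (repr u) (repr v)).
Definition leavitt_mul (u v : leavitt2) := leavitt_pi (LMul (repr u) (repr v)).

Lemma leavitt_oppE s : leavitt_opp (leavitt_pi s) = leavitt_pi (LOpp s).
Proof. by apply/leavitt_piP/lc_opp/leavitt_repr. Qed.

Lemma leavitt_addE s t :
  leavitt_add (leavitt_pi s) (leavitt_pi t) = leavitt_pi (LAdd s t).
Proof. by apply/leavitt_piP/lc_add; apply: leavitt_repr. Qed.

Lemma leavitt_mulE s t :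
  leavitt_mul (leavitt_pi s) (leavitt_pi t) = leavitt_pi (LMul s t).
Proof. by apply/leavitt_piP/lc_mul; apply: leavitt_repr. Qed.

Let opE := (leavitt_oppE, leavitt_addE, leavitt_mulE).

Fact leavitt_addA : associative leavitt_add.
Proof.
elim/leavitt_ind=> s; elim/leavitt_ind=> t; elim/leavitt_ind=> u.
by rewrite !opE; apply/leavitt_piP/lc_addA.
Qed.

Fact leavitt_addC : commutative leavitt_add.
Proof.
elim/leavitt_ind=> s; elim/leavitt_ind=> t.
by rewrite !opE; apply/leavitt_piP/lc_addC.
Qed.

Fact leavitt_add0 : left_id (leavitt_pi LZero) leavitt_add.
Proof. by elim/leavitt_ind=> s; rewrite opE; apply/leavitt_piP/lc_add0. Qed.

Fact leavitt_addN : left_inverse (leavitt_pi LZero) leavitt_opp leavitt_add.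
Proof. by elim/leavitt_ind=> s; rewrite !opE; apply/leavitt_piP/lc_addN. Qed.

Fact leavitt_mulA : associative leavitt_mul.
Proof.
elim/leavitt_ind=> s; elim/leavitt_ind=> t; elim/leavitt_ind=> u.
by rewrite !opE; apply/leavitt_piP/lc_mulA.
Qed.

Fact leavitt_mul1l : left_id (leavitt_pi LOne) leavitt_mul.
Proof. by elim/leavitt_ind=> s; rewrite opE; apply/leavitt_piP/lc_mul1l. Qed.

Fact leavitt_mul1r : right_id (leavitt_pi LOne) leavitt_mul.
Proof. by elim/leavitt_ind=> s; rewrite opE; apply/leavitt_piP/lc_mul1r. Qed.

Fact leavitt_mulDl : left_distributive leavitt_mul leavitt_add.
Proof.
elim/leavitt_ind=> s; elim/leavitt_ind=> t; elim/leavitt_ind=> u.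
by rewrite !opE; apply/leavitt_piP/lc_mulDl.
Qed.

Fact leavitt_mulDr : right_distributive leavitt_mul leavitt_add.
Proof.
elim/leavitt_ind=> s; elim/leavitt_ind=> t; elim/leavitt_ind=> u.
by rewrite !opE; apply/leavitt_piP/lc_mulDr.
Qed.

HB.instance Definition _ := GRing.isZmodule.Build leavitt2
  leavitt_addA leavitt_addC leavitt_add0 leavitt_addN.
HB.instance Definition _ := GRing.Zmodule_isPzRing.Build leavitt2
  leavitt_mulA leavitt_mul1l leavitt_mul1r leavitt_mulDl leavitt_mulDr.

Lemma leavitt_pi0 : leavitt_pi LZero = 0. Proof. by []. Qed.
Lemma leavitt_pi1 : leavitt_pi LOne = 1. Proof. by []. Qed.

Lemma leavitt_piN s : leavitt_pi (LOpp s) = - leavitt_pi s.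
Proof. by rewrite -leavitt_oppE. Qed.

Lemma leavitt_piD s t : leavitt_pi (LAdd s t) = leavitt_pi s + leavitt_pi t.
Proof. by rewrite -leavitt_addE. Qed.

Lemma leavitt_piM s t : leavitt_pi (LMul s t) = leavitt_pi s * leavitt_pi t.
Proof. by rewrite -leavitt_mulE. Qed.

Definition la : leavitt2 := leavitt_pi LA.
Definition las : leavitt2 := leavitt_pi LAs.
Definition lb : leavitt2 := leavitt_pi LB.
Definition lbs : leavitt2 := leavitt_pi LBs.

Lemma las_la : las * la = 1.
Proof. by rewrite -leavitt_piM; apply/leavitt_piP/lc_aa. Qed.

Lemma lbs_lb : lbs * lb = 1.
Proof. by rewrite -leavitt_piM; apply/leavitt_piP/lc_bb. Qed.

Lemma la_lb : la * las + lb * lbs = 1.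
Proof. by rewrite -!leavitt_piM -leavitt_piD; apply/leavitt_piP/lc_ab. Qed.

Fixpoint leavitt_eval (R : pzRingType) (x xs y ys : R) (s : leavitt_term) : R :=
  match s with
  | LA => x | LAs => xs | LB => y | LBs => ys
  | LZero => 0 | LOne => 1
  | LOpp s => - leavitt_eval x xs y ys s
  | LAdd s t => leavitt_eval x xs y ys s + leavitt_eval x xs y ys t
  | LMul s t => leavitt_eval x xs y ys s * leavitt_eval x xs y ys t
  end.

Lemma leavitt_eval_cong (R : pzRingType) (x xs y ys : R) :
    xs * x = 1 -> ys * y = 1 -> x * xs + y * ys = 1 ->
  forall s t, leavitt_cong s t ->
    leavitt_eval x xs y ys s = leavitt_eval x xs y ys t.
Proof.
move=> xx yy xy s t; elim=> //= {s t}.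
- by move=> s t u _ -> _ ->.
- by move=> s s' _ ->.
- by move=> s s' t t' _ -> _ ->.
- by move=> s s' t t' _ -> _ ->.
- by move=> s t u; rewrite addrA.
- by move=> s t; rewrite addrC.
- by move=> s; rewrite add0r.
- by move=> s; rewrite addNr.
- by move=> s t u; rewrite mulrA.
- by move=> s; rewrite mul1r.
- by move=> s; rewrite mulr1.
- by move=> s t u; rewrite mulrDl.
- by move=> s t u; rewrite mulrDr.
Qed.

Lemma leavitt_universal (R : pzRingType) (x xs y ys : R) :
    xs * x = 1 -> ys * y = 1 -> x * xs + y * ys = 1 ->
  exists f : {rmorphism leavitt2 -> R},
    [/\ f la = x, f las = xs, f lb = y & f lbs = ys].
Proof.
move=> xx yy xy; pose f (u : leavitt2) := leavitt_eval x xs y ys (repr u).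
have fE s : f (leavitt_pi s) = leavitt_eval x xs y ys s.
  exact: leavitt_eval_cong (leavitt_repr s).
have fB : zmod_morphism f.
  elim/leavitt_ind=> s; elim/leavitt_ind=> t.
  by rewrite -leavitt_piN -leavitt_piD !fE.
have fM : monoid_morphism f.
  split; first by rewrite -leavitt_pi1 fE.
  elim/leavitt_ind=> s; elim/leavitt_ind=> t.
  by rewrite -leavitt_piM !fE.
pose fa := GRing.isZmodMorphism.Build _ _ f fB.
pose fm := GRing.isMonoidMorphism.Build _ _ f fM.
pose F : {rmorphism leavitt2 -> R} := HB.pack f fa fm.
by exists F; split; apply: fE.
Qed.

Lemma leavitt_universal_uniq (R : pzRingType) (f g : {rmorphism leavitt2 -> R}) :
  f la = g la -> f las = g las -> f lb = g lb -> f lbs = g lbs -> f =1 g.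
Proof.
move=> ea eas eb ebs; elim/leavitt_ind; elim=> //.
- by rewrite leavitt_pi0 !rmorph0.
- by rewrite leavitt_pi1 !rmorph1.
- by move=> s IHs; rewrite leavitt_piN !rmorphN IHs.
- by move=> s IHs t IHt; rewrite leavitt_piD !rmorphD IHs IHt.
- by move=> s IHs t IHt; rewrite leavitt_piM !rmorphM IHs IHt.
Qed.

Fixpoint lterm_star (s : leavitt_term) : leavitt_term :=
  match s with
  | LA => LAs | LAs => LA | LB => LBs | LBs => LB
  | LZero => LZero | LOne => LOne
  | LOpp s => LOpp (lterm_star s)
  | LAdd s t => LAdd (lterm_star s) (lterm_star t)
  | LMul s t => LMul (lterm_star t) (lterm_star s)
  end.

Lemma lterm_starK : involutive lterm_star.
Proof. by elim=> //= [s ->|s -> t ->|s -> t ->]. Qed.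

Lemma lterm_star_cong s t :
  leavitt_cong s t -> leavitt_cong (lterm_star s) (lterm_star t).
Proof.
elim=> /= {s t}; try by move=> *; constructor.
- by move=> s t u _ st _ tu; apply: lc_trans st tu.
- by move=> s t u; apply/lc_sym/lc_mulA.
Qed.

(* By lemma [star_lword] below, this is the additive map sending              *)
(* alpha beta^* to beta alpha^*.                                              *)
Definition leavitt_star (u : leavitt2) : leavitt2 :=
  leavitt_pi (lterm_star (repr u)).

Lemma leavitt_starE s : leavitt_star (leavitt_pi s) = leavitt_pi (lterm_star s).
Proof. by apply/leavitt_piP/lterm_star_cong/leavitt_repr. Qed.

Fact leavitt_starD : {morph leavitt_star : u v / u + v}.
Proof.
elim/leavitt_ind=> s; elim/leavitt_ind=> t.
by rewrite -leavitt_piD !leavitt_starE -leavitt_piD.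
Qed.

Fact leavitt_starM u v : leavitt_star (u * v) = leavitt_star v * leavitt_star u.
Proof.
elim/leavitt_ind: u => s; elim/leavitt_ind: v => t.
by rewrite -leavitt_piM !leavitt_starE -leavitt_piM.
Qed.

Fact leavitt_starK : involutive leavitt_star.
Proof. by elim/leavitt_ind=> s; rewrite !leavitt_starE lterm_starK. Qed.

HB.instance Definition _ :=
  hasStar.Build leavitt2 leavitt_starD leavitt_starM leavitt_starK.

Lemma star_la : star la = las. Proof. exact: leavitt_starE. Qed.
Lemma star_lb : star lb = lbs. Proof. exact: leavitt_starE. Qed.
Lemma star_las : star las = la. Proof. exact: leavitt_starE. Qed.
Lemma star_lbs : star lbs = lb. Proof. exact: leavitt_starE. Qed.

(* Words in a, b: [false] stands for the letter a, [true] for b. *)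
Definition lword (w : seq bool) : leavitt2 :=
  \prod_(c <- w) (if c then lb else la).
Definition lword_star (w : seq bool) : leavitt2 :=
  \prod_(c <- rev w) (if c then lbs else las).

Lemma star_lword1 w : star (lword w) = lword_star w.
Proof.
rewrite /lword /lword_star; elim: w => [|c w IHw].
  by rewrite !big_nil star1.
rewrite big_cons rev_cons -cats1 big_cat big_seq1 /= starM IHw.
by case: c; rewrite ?star_la ?star_lb.
Qed.

Lemma star_lword alpha beta :
  star (lword alpha * lword_star beta) = lword beta * lword_star alpha.
Proof. by rewrite starM -!star_lword1 starK. Qed.

End Leavitt.

Section Tensor.

(* Additive groups are Z-modules, and biadditive maps are Z-bilinear maps. *)
Definition biadditive (A B M : zmodType) (f : A -> B -> M) : Prop :=
  (forall x x' y, f (x + x') y = f x y + f x' y) /\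
  (forall x y y', f x (y + y') = f x y + f x y').

Inductive tensor_term (A B : Type) : Type :=
| TPure of A & B
| TZero
| TOpp of tensor_term A B
| TAdd of tensor_term A B & tensor_term A B.

HB.instance Definition _ A B := gen_eqMixin (tensor_term A B).
HB.instance Definition _ A B := gen_choiceMixin (tensor_term A B).

Arguments TZero {A B}.

(* The abelian group congruence making [TPure] biadditive. *)
Inductive tensor_cong (A B : zmodType) :
  tensor_term A B -> tensor_term A B -> Prop :=
| tc_refl s : tensor_cong s s
| tc_sym s t : tensor_cong s t -> tensor_cong t s
| tc_trans s t u : tensor_cong s t -> tensor_cong t u -> tensor_cong s u
| tc_opp s s' : tensor_cong s s' -> tensor_cong (TOpp s) (TOpp s')
| tc_add s s' t t' : tensor_cong s s' -> tensor_cong t t' ->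
    tensor_cong (TAdd s t) (TAdd s' t')
| tc_addA s t u : tensor_cong (TAdd s (TAdd t u)) (TAdd (TAdd s t) u)
| tc_addC s t : tensor_cong (TAdd s t) (TAdd t s)
| tc_add0 s : tensor_cong (TAdd TZero s) s
| tc_addN s : tensor_cong (TAdd (TOpp s) s) TZero
| tc_pureDl x x' y :
    tensor_cong (TPure (x + x') y) (TAdd (TPure x y) (TPure x' y))
| tc_pureDr x y y' :
    tensor_cong (TPure x (y + y')) (TAdd (TPure x y) (TPure x y')).

Section TensorGroup.
Variables A B : zmodType.

Definition tensor_rel : rel (tensor_term A B) :=
  fun s t => `[< tensor_cong s t >].

Lemma tensor_rel_refl : reflexive tensor_rel.
Proof. by move=> s; apply/asboolP; apply: tc_refl. Qed.

Lemma tensor_rel_sym : symmetric tensor_rel.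
Proof. by move=> s t; apply/asboolP/asboolP; apply: tc_sym. Qed.

Lemma tensor_rel_trans : transitive tensor_rel.
Proof.
by move=> t s u /asboolP st /asboolP tu; apply/asboolP; apply: tc_trans st tu.
Qed.

Canonical tensor_equiv : equiv_rel (tensor_term A B) :=
  EquivRel tensor_rel tensor_rel_refl tensor_rel_sym tensor_rel_trans.

Definition tensor : Type := {eq_quot tensor_equiv}.

HB.instance Definition _ := Choice.on tensor.
HB.instance Definition _ := EqQuotient.on tensor.

Definition tensor_pi (s : tensor_term A B) : tensor := \pi_tensor s.

Lemma tensor_piP s t : tensor_pi s = tensor_pi t <-> tensor_cong s t.
Proof.
by split=> [/eqquotP/asboolP//|st]; apply/eqquotP/asboolP.
Qed.

Lemma tensor_repr s : tensor_cong (repr (tensor_pi s)) s.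
Proof. by apply/tensor_piP; rewrite /tensor_pi reprK. Qed.

Lemma tensor_pi_ind (P : tensor -> Prop) :
  (forall s, P (tensor_pi s)) -> forall u, P u.
Proof. by move=> Ps u; rewrite -[u]reprK; apply: Ps. Qed.

Definition tensor_opp (u : tensor) := tensor_pi (TOpp (repr u)).
Definition tensor_add (u v : tensor) := tensor_pi (TAdd (repr u) (repr v)).

Lemma tensor_oppE s : tensor_opp (tensor_pi s) = tensor_pi (TOpp s).
Proof. by apply/tensor_piP/tc_opp/tensor_repr. Qed.

Lemma tensor_addE s t :
  tensor_add (tensor_pi s) (tensor_pi t) = tensor_pi (TAdd s t).
Proof. by apply/tensor_piP/tc_add; apply: tensor_repr. Qed.

Fact tensor_addA : associative tensor_add.
Proof.
elim/tensor_pi_ind=> s; elim/tensor_pi_ind=> t; elim/tensor_pi_ind=> u.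
by rewrite !tensor_addE; apply/tensor_piP/tc_addA.
Qed.

Fact tensor_addC : commutative tensor_add.
Proof.
elim/tensor_pi_ind=> s; elim/tensor_pi_ind=> t.
by rewrite !tensor_addE; apply/tensor_piP/tc_addC.
Qed.

Fact tensor_add0 : left_id (tensor_pi TZero) tensor_add.
Proof.
by elim/tensor_pi_ind=> s; rewrite tensor_addE; apply/tensor_piP/tc_add0.
Qed.

Fact tensor_addN : left_inverse (tensor_pi TZero) tensor_opp tensor_add.
Proof.
elim/tensor_pi_ind=> s.
by rewrite tensor_oppE tensor_addE; apply/tensor_piP/tc_addN.
Qed.

HB.instance Definition _ := GRing.isZmodule.Build tensor
  tensor_addA tensor_addC tensor_add0 tensor_addN.

Definition tens (x : A) (y : B) : tensor := tensor_pi (TPure x y).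

Lemma tensor_piN s : tensor_pi (TOpp s) = - tensor_pi s.
Proof. by rewrite -tensor_oppE. Qed.

Lemma tensor_piD s t : tensor_pi (TAdd s t) = tensor_pi s + tensor_pi t.
Proof. by rewrite -tensor_addE. Qed.

Lemma tens_biadditive : biadditive tens.
Proof.
split=> *; rewrite /tens -tensor_piD; apply/tensor_piP.
  exact: tc_pureDl.
exact: tc_pureDr.
Qed.

Lemma tensor_ind (P : tensor -> Prop) :
    P 0 -> (forall u, P u -> P (- u)) ->
    (forall u v, P u -> P v -> P (u + v)) ->
    (forall x y, P (tens x y)) ->
  forall u, P u.
Proof.
move=> P0 PN PD Pt; elim/tensor_pi_ind; elim=> //.
- by move=> s Ps; rewrite tensor_piN; apply: PN.
- by move=> s Ps t Pt'; rewrite tensor_piD; apply: PD.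
Qed.

Section Lift.
Variables (M : zmodType) (f : A -> B -> M).

Fixpoint tensor_eval (s : tensor_term A B) : M :=
  match s with
  | TPure x y => f x y
  | TZero => 0
  | TOpp s => - tensor_eval s
  | TAdd s t => tensor_eval s + tensor_eval t
  end.

(* Meaningful only for biadditive f, in which case it is the additive map     *)
(* sending [tens x y] to [f x y].                                             *)
Definition tensor_lift (u : tensor) : M := tensor_eval (repr u).

Hypothesis f_biadd : biadditive f.

Lemma tensor_eval_cong s t : tensor_cong s t -> tensor_eval s = tensor_eval t.
Proof.
elim=> //= {s t}.
- by move=> s t u _ -> _ ->.
- by move=> s s' _ ->.
- by move=> s s' t t' _ -> _ ->.
- by move=> s t u; rewrite addrA.
- by move=> s t; rewrite addrC.
- by move=> s; rewrite add0r.
- by move=> s; rewrite addNr.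
- by case: f_biadd.
- by case: f_biadd.
Qed.

Lemma tensor_liftE s : tensor_lift (tensor_pi s) = tensor_eval s.
Proof. exact: tensor_eval_cong (tensor_repr s). Qed.

Lemma tensor_lift_tens x y : tensor_lift (tens x y) = f x y.
Proof. exact: tensor_liftE. Qed.

Lemma tensor_lift0 : tensor_lift 0 = 0.
Proof. exact: tensor_liftE TZero. Qed.

Lemma tensor_liftN : {morph tensor_lift : u / - u}.
Proof. by elim/tensor_pi_ind=> s; rewrite -tensor_piN !tensor_liftE. Qed.

Lemma tensor_liftD : {morph tensor_lift : u v / u + v}.
Proof.
elim/tensor_pi_ind=> s; elim/tensor_pi_ind=> t.
by rewrite -tensor_piD !tensor_liftE.
Qed.

End Lift.

Lemma additive_tensor_ext (M : zmodType) (g h : tensor -> M) :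
    {morph g : u v / u + v} -> {morph h : u v / u + v} ->
    (forall x y, g (tens x y) = h (tens x y)) ->
  g =1 h.
Proof.
have m0 (k : tensor -> M) : {morph k : u v / u + v} -> k 0 = 0.
  by move=> kD; apply: (addrI (k 0)); rewrite -kD !addr0.
have mN (k : tensor -> M) : {morph k : u v / u + v} -> {morph k : u / - u}.
  by move=> kD u; apply: (addrI (k u)); rewrite -kD !subrr m0.
move=> gD hD gh; elim/tensor_ind => //.
- by rewrite !m0.
- by move=> u gu; rewrite !mN // gu.
- by move=> u v gu gv; rewrite gD hD gu gv.
Qed.

End TensorGroup.

Section TensorRing.
Variables A B : pzRingType.
Notation T := (tensor A B).

Definition tensor_mul_tens (x : A) (y : B) : T -> T :=
  tensor_lift (fun x' y' => tens (x * x') (y * y')).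

(* (x ⊗ y)(x' ⊗ y') = xx' ⊗ yy', extended biadditively. *)
Definition tensor_mul (u v : T) : T :=
  tensor_lift (fun x y => tensor_mul_tens x y v) u.

Lemma tensor_mul_tens_biadd x y :
  biadditive (fun x' y' => tens (x * x') (y * y') : T).
Proof.
have [tl tr] := tens_biadditive A B.
by split=> *; rewrite mulrDr ?tl ?tr.
Qed.

Lemma tensor_mul_biadd v : biadditive (fun x y => tensor_mul_tens x y v).
Proof.
have [tl tr] := tens_biadditive A B.
have bi := tensor_mul_tens_biadd.
split=> [x x' y|x y y']; elim/tensor_ind: v.
- by rewrite /tensor_mul_tens !tensor_lift0 // addr0.
- by move=> u IH; rewrite /tensor_mul_tens in IH *; rewrite !tensor_liftN // IH opprD.
- move=> u v IHu IHv; rewrite /tensor_mul_tens in IHu IHv *.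
  by rewrite !tensor_liftD // IHu IHv addrACA.
- by move=> *; rewrite /tensor_mul_tens !tensor_lift_tens // mulrDl tl.
- by rewrite /tensor_mul_tens !tensor_lift0 // addr0.
- by move=> u IH; rewrite /tensor_mul_tens in IH *; rewrite !tensor_liftN // IH opprD.
- move=> u v IHu IHv; rewrite /tensor_mul_tens in IHu IHv *.
  by rewrite !tensor_liftD // IHu IHv addrACA.
- by move=> *; rewrite /tensor_mul_tens !tensor_lift_tens // mulrDl tr.
Qed.

Lemma tensor_mul_tensE x y x' y' :
  tensor_mul (tens x y) (tens x' y') = tens (x * x') (y * y').
Proof.
rewrite /tensor_mul tensor_lift_tens; last exact: tensor_mul_biadd.
by rewrite /tensor_mul_tens tensor_lift_tens //; apply: tensor_mul_tens_biadd.
Qed.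

Fact tensor_mulDl : left_distributive tensor_mul +%R.
Proof. by move=> u v w; apply/tensor_liftD/tensor_mul_biadd. Qed.

Fact tensor_mulDr : right_distributive tensor_mul +%R.
Proof.
move=> u v w; move: u.
apply: additive_tensor_ext; first by move=> *; apply: tensor_mulDl.
  by move=> u u'; rewrite !tensor_mulDl addrACA.
move=> x y; rewrite /tensor_mul !tensor_lift_tens; try exact: tensor_mul_biadd.
by rewrite /tensor_mul_tens tensor_liftD //; apply: tensor_mul_tens_biadd.
Qed.

Fact tensor_mulA : associative tensor_mul.
Proof.
move=> u v w; move: u; apply: additive_tensor_ext.
- by move=> *; apply: tensor_mulDl.
- by move=> u u'; rewrite !tensor_mulDl.
move=> x y; move: v; apply: additive_tensor_ext.
- by move=> *; rewrite tensor_mulDl tensor_mulDr.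
- by move=> *; rewrite tensor_mulDr tensor_mulDl.
move=> x' y'; move: w; apply: additive_tensor_ext.
- by move=> *; rewrite !tensor_mulDr.
- by move=> *; rewrite !tensor_mulDr.
by move=> x'' y''; rewrite !tensor_mul_tensE !mulrA.
Qed.

Fact tensor_mul1l : left_id (tens 1 1) tensor_mul.
Proof.
apply: additive_tensor_ext => //; first by move=> *; rewrite tensor_mulDr.
by move=> x y; rewrite tensor_mul_tensE !mul1r.
Qed.

Fact tensor_mul1r : right_id (tens 1 1) tensor_mul.
Proof.
apply: additive_tensor_ext => //; first by move=> *; rewrite tensor_mulDl.
by move=> x y; rewrite tensor_mul_tensE !mulr1.
Qed.

HB.instance Definition _ := GRing.Zmodule_isPzRing.Build T
  tensor_mulA tensor_mul1l tensor_mul1r tensor_mulDl tensor_mulDr.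

Lemma tens11 : tens 1 1 = 1 :> T. Proof. by []. Qed.

Lemma tensM x y x' y' : tens x y * tens x' y' = tens (x * x') (y * y') :> T.
Proof. exact: tensor_mul_tensE. Qed.

End TensorRing.

Section TensorStar.
Variables A B : starRingType.
Notation T := (tensor A B).

Definition tensor_star : T -> T :=
  tensor_lift (fun x y => tens (star x) (star y)).

Lemma tensor_star_biadd : biadditive (fun (x : A) (y : B) => tens (star x) (star y)).
Proof.
have [tl tr] := tens_biadditive A B.
by split=> *; rewrite starD ?tl ?tr.
Qed.

Lemma tensor_star_tens x y : tensor_star (tens x y) = tens (star x) (star y).
Proof. exact/tensor_lift_tens/tensor_star_biadd. Qed.

Fact tensor_starD : {morph tensor_star : u v / u + v}.
Proof. exact/tensor_liftD/tensor_star_biadd. Qed.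

Fact tensor_starM u v : tensor_star (u * v) = tensor_star v * tensor_star u.
Proof.
move: u; apply: additive_tensor_ext.
- by move=> *; rewrite mulrDl tensor_starD.
- by move=> *; rewrite tensor_starD mulrDr.
move=> x y; move: v; apply: additive_tensor_ext.
- by move=> *; rewrite mulrDr tensor_starD.
- by move=> *; rewrite tensor_starD mulrDl.
by move=> x' y'; rewrite tensM !tensor_star_tens tensM !starM.
Qed.

Fact tensor_starK : involutive tensor_star.
Proof.
apply: additive_tensor_ext => //; first by move=> *; rewrite !tensor_starD.
by move=> x y; rewrite !tensor_star_tens !starK.
Qed.

HB.instance Definition _ :=
  hasStar.Build T tensor_starD tensor_starM tensor_starK.

Lemma star_tens (x : A) (y : B) : star (tens x y) = tens (star x) (star y) :> T.
Proof. exact: tensor_star_tens. Qed.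

End TensorStar.

End Tensor.

(* Main.v *)
From HB Require Import structures.
Require Import Defs.
From mathcomp Require Import all_boot all_order all_algebra.
From mathcomp Require Import boolp zify.

(* An embedding [f] gives two commuting unital *-endomorphisms                *)
(* [F x = f (x (x) 1)] and [G y = f (1 (x) y)] of L_{2,Z}, and these cannot   *)
(* exist. An element [z] with [star z * z = 1] maps every long enough word to *)
(* plus or minus a word: the squares of the integer coefficients of [z * w]   *)
(* sum to 1. So the isometries [F g], for [g] a word, act on words by prefix  *)
(* replacement, like a pushdown automaton. The images of words under distinct *)
(* [F g] are pairwise incomparable for the prefix order, hence some of them   *)
(* get long, and by pigeonhole on the top of the stack there are words        *)
(* [d], [p] and [u], with [u] nonempty, such that [F d] maps [p] to [p ++ u]. *)
(* Every [G g] commutes with [F d] and so maps some word [p ++ u ++ ... ++ u] *)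
(* to a word [x] which [F d] maps to [x ++ u]. The [x] obtained from distinct *)
(* [g] of the same length are incomparable. But if [F d] is given by prefix   *)
(* replacement on words of length [N], then [x] is a prefix of an infinite    *)
(* periodic word determined by its first [N] letters, so that there cannot be *)
(* [2 ^ N.+1] incomparable ones.                                              *)

(** Integrality enters in [word_span_isometry]: integers whose squares sum to 1 are all 0 except a
    single 1 or -1. Orthogonality of words of equal length then becomes incomparability for the
    prefix order ([star_morph_incomparable]), which turns the problem into counting words.
    [pumps_self] finds a periodic growth of one endomorphism, the commuting one copies it to
    exponentially many incomparable words, and [cat_shift_comparable] shows that only boundedly many
    can exist. The two sides meet in [no_commuting_star_endo]. *)

Set Implicit Arguments.
Unset Strict Implicit.
Unset Printing Implicit Defensive.

Import Order.TTheory GRing.Theory Num.Theory.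
Local Open Scope ring_scope.

(** * The representation on functions on infinite words *)

(* L_{2,Z} acts on the functions on the infinite binary words with finitely   *)
(* many ones, encoded as natural numbers, least significant digit first.      *)
Fixpoint lterm_act (s : leavitt_term) (phi : nat -> int) : nat -> int :=
  match s with
  | LA => fun k => if odd k then 0 else phi k./2
  | LAs => fun k => phi k.*2
  | LB => fun k => if odd k then phi k./2 else 0
  | LBs => fun k => phi k.*2.+1
  | LZero => fun=> 0
  | LOne => phi
  | LOpp s => fun k => - lterm_act s phi k
  | LAdd s t => fun k => lterm_act s phi k + lterm_act t phi k
  | LMul s t => lterm_act s (lterm_act t phi)
  end.

(** Products act by composition, so the law [lc_mulDr] holds in the action only because every term
    acts additively. *)
Lemma lterm_actD s phi psi k :
  lterm_act s (fun i => phi i + psi i) k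
    = lterm_act s phi k + lterm_act s psi k.
Proof.
elim: s phi psi k => //=.
- by move=> phi psi k; case: ifP => // _; rewrite addr0.
- by move=> phi psi k; case: ifP => // _; rewrite addr0.
- by move=> s IHs phi psi k; rewrite IHs opprD.
- by move=> s IHs t IHt phi psi k; rewrite IHs IHt addrACA.
- move=> s IHs t IHt phi psi k; rewrite -IHs; congr (lterm_act s _ k).
  by apply: funext => i; apply: IHt.
Qed.

Lemma lterm_act_cong s t : leavitt_cong s t -> lterm_act s = lterm_act t.
Proof.
move=> st; apply: funext => phi; elim: st phi => //= {s t}.
- by move=> s t u _ IHst _ IHtu phi; rewrite IHst.
- by move=> s s' _ IHs phi; rewrite IHs.
- by move=> s s' t t' _ IHs _ IHt phi; rewrite IHs IHt.
- by move=> s s' t t' _ IHs _ IHt phi; rewrite IHt IHs.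
- by move=> s t u phi; apply: funext => k; rewrite addrA.
- by move=> s t phi; apply: funext => k; rewrite addrC.
- by move=> s phi; apply: funext => k; rewrite add0r.
- by move=> s phi; apply: funext => k; rewrite addNr.
- by move=> s t u phi; apply: funext => k; rewrite lterm_actD.
- by move=> phi; apply: funext => k; rewrite odd_double doubleK.
- by move=> phi; apply: funext => k /=; rewrite odd_double uphalf_double.
(* [LMul LA LAs] restricts a function to even numbers and [LMul LB LBs] to odd ones. *)
- move=> phi; apply: funext => k.
  rewrite -[k in RHS]odd_double_half.
  by case: (odd k); rewrite ?add0r ?addr0.
Qed.

Definition lact (x : leavitt2) : (nat -> int) -> nat -> int :=
  lterm_act (repr x).

Lemma lact_pi s : lact (leavitt_pi s) = lterm_act s.
Proof. exact/lterm_act_cong/leavitt_repr. Qed.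

Lemma lactD x y phi k : lact (x + y) phi k = lact x phi k + lact y phi k.
Proof.
by elim/leavitt_ind: x => s; elim/leavitt_ind: y => t;
   rewrite -leavitt_piD !lact_pi.
Qed.

Lemma lactN x phi k : lact (- x) phi k = - lact x phi k.
Proof. by elim/leavitt_ind: x => s; rewrite -leavitt_piN !lact_pi. Qed.

Lemma lactM x y phi : lact (x * y) phi = lact x (lact y phi).
Proof.
by elim/leavitt_ind: x => s; elim/leavitt_ind: y => t;
   rewrite -leavitt_piM !lact_pi.
Qed.

(** * Words and their orthogonality *)

Lemma lword_cons c w : lword (c :: w) = (if c then lb else la) * lword w.
Proof. by rewrite /lword big_cons. Qed.

Lemma lword_cat u v : lword (u ++ v) = lword u * lword v.
Proof. by rewrite /lword big_cat. Qed.

Lemma lword_nil : lword [::] = 1.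
Proof. by rewrite /lword big_nil. Qed.

Lemma lword_star_cons c w :
  lword_star (c :: w) = lword_star w * (if c then lbs else las).
Proof. by rewrite /lword_star rev_cons -cats1 big_cat big_seq1. Qed.

Lemma lword_star_nil : lword_star [::] = 1.
Proof. by rewrite /lword_star big_nil. Qed.

(** Multiplying [la_lb] by [las] on the left and by [lb] on the right yields twice [las * lb] on one
    side and [las * lb] on the other. *)
Lemma las_lb : las * lb = 0.
Proof.
have: las * (la * las + lb * lbs) * lb = las * lb by rewrite la_lb mulr1.
rewrite mulrDr mulrDl !mulrA las_la mul1r -!mulrA lbs_lb mulr1 => /eqP.
by rewrite -subr_eq0 addrK => /eqP.
Qed.

Lemma star0 (R : starRingType) : star (0 : R) = 0.
Proof. by apply: (addrI (star 0)); rewrite -starD !addr0. Qed.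

Lemma starN (R : starRingType) : {morph star : x / - x : R}.
Proof. by move=> x; apply: (addrI (star x)); rewrite -starD !subrr star0. Qed.

Lemma star_sign (R : starRingType) (s : bool) :
  star ((-1) ^+ s : R) = (-1) ^+ s.
Proof. by case: s; rewrite ?starN star1. Qed.

Lemma lbs_la : lbs * la = 0.
Proof. by rewrite -star_lb -star_las -starM las_lb star0. Qed.

Lemma lword_ortho u v :
  size u = size v -> lword_star u * lword v = (u == v)%:R.
Proof.
elim: u v => [|c u IHu] [|d v] //=.
  by rewrite lword_star_nil lword_nil mulr1.
case=> uv; rewrite lword_star_cons lword_cons eqseq_cons -mulrA.
rewrite [X in _ * X]mulrA.
by case: c d => [] [] /=;
   rewrite ?las_la ?lbs_lb ?las_lb ?lbs_la ?mul1r ?mul0r ?mulr0 ?IHu.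
Qed.

Lemma lword_starK u : lword_star u * lword u = 1.
Proof. by rewrite lword_ortho // eqxx. Qed.

(** * Coefficients of words *)

Definition word_shift (w : seq bool) (k : nat) : nat :=
  foldr (fun (c : bool) k => c + k.*2)%N k w.

Lemma word_shift_gt0 w k : (0 < k)%N -> (0 < word_shift w k)%N.
Proof. by move=> k0; elim: w => //= c w; lia. Qed.

(** The seed 1 marks the end of the word; with seed 0, words differing by trailing [false] letters
    would get the same code. *)
Lemma word_shift_inj : injective (word_shift^~ 1%N).
Proof.
elim=> [|c u IHu] [|d v] //=.
- by have := @word_shift_gt0 v 1 isT; lia.
- by have := @word_shift_gt0 u 1 isT; lia.
- move=> e; have [-> /IHu -> //] : c = d /\ word_shift u 1 = word_shift v 1.
  by move: c d e => [] []; split=> //; lia.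
Qed.

(** [lword v] moves the indicator of 1 to the indicator of [word_shift v 1], so on combinations of
    words this reads off the coefficient of [w]. *)
Definition coef (w : seq bool) (x : leavitt2) : int :=
  lact x (fun k => (k == 1%N)%:R) (word_shift w 1).

Lemma coefD w x y : coef w (x + y) = coef w x + coef w y.
Proof. exact: lactD. Qed.

Lemma coefN w x : coef w (- x) = - coef w x.
Proof. exact: lactN. Qed.

Lemma coef0 w : coef w 0 = 0.
Proof. by rewrite /coef -leavitt_pi0 lact_pi. Qed.

Lemma coef_lword w v : coef w (lword v) = (w == v)%:R.
Proof.
rewrite -(inj_eq word_shift_inj) /coef; move: (word_shift w 1).
elim: v => [|c v IHv] k; first by rewrite lword_nil -leavitt_pi1 lact_pi.
rewrite lword_cons lactM (funext IHv).
by case: c; rewrite /la /lb lact_pi /=; case: ifP => k_odd;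
   do ?case: eqP => //; lia.
Qed.

Lemma coef_lword_star w x : coef [::] (lword_star w * x) = coef w x.
Proof.
rewrite /coef lactM; move: (lact x _) => phi.
suff actE k : lact (lword_star w) phi k = phi (word_shift w k) by rewrite actE.
elim: w phi k => [|c w IHw] phi k.
  by rewrite lword_star_nil -leavitt_pi1 lact_pi.
rewrite lword_star_cons lactM IHw.
by case: c; rewrite /las /lbs lact_pi.
Qed.


Lemma lword_neq0 w : lword w <> 0.
Proof.
by move=> w0; have := coef_lword w w; rewrite w0 coef0 eqxx.
Qed.

Lemma lword_sign_inj (s t : bool) u v :
  (-1) ^+ s * lword u = (-1) ^+ t * lword v -> u = v.
Proof.
have coefS (b : bool) w x : coef w ((-1) ^+ b * x) = (-1) ^+ b * coef w x.
  by case: b; rewrite ?expr1 ?expr0 ?mulN1r ?mul1r // coefN.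
move=> /(congr1 (coef u)); rewrite !coefS !coef_lword eqxx.
by case: (u =P v) => //; case: s; case: t.
Qed.

(** * Words mapped to signed words *)

Definition sends (z : leavitt2) (u w : seq bool) : Prop :=
  exists s : bool, z * lword u = (-1) ^+ s * lword w.

Lemma sends_cat z u w v : sends z u w -> sends z (u ++ v) (w ++ v).
Proof. by case=> s zu; exists s; rewrite !lword_cat !mulrA zu. Qed.

Lemma sendsM y z u v w : sends z u v -> sends y v w -> sends (y * z) u w.
Proof.
case=> s zu [t yv]; exists (s (+) t).
by rewrite -mulrA zu mulrA commr_sign -mulrA yv mulrA -signr_addb.
Qed.

Lemma sends_uniq z u v w : sends z u v -> sends z u w -> v = w.
Proof. by case=> s zu [t]; rewrite zu => /lword_sign_inj. Qed.

Lemma sends1 u : sends 1 u u.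
Proof. by exists false; rewrite !mul1r. Qed.

(** If [v'] were [v ++ x], then [star (y * lword u) * (z * lword u')] would be plus or minus
    [lword x], which is nonzero. *)
Lemma sends_not_prefix y z u u' v v' :
    lword_star u * (star y * z) * lword u' = 0 ->
  sends y u v -> sends z u' v' -> ~~ prefix v v'.
Proof.
move=> yz0 [s yu] [t zu']; apply/negP => /prefixP[x v'E].
have: star (y * lword u) * (z * lword u') = 0.
  by rewrite starM star_lword1 -yz0 !mulrA.
rewrite yu zu' starM star_sign star_lword1 v'E lword_cat -mulrA.
rewrite [X in _ * X]mulrA -signr_addb mulrA commr_sign -mulrA.
rewrite [X in _ * X]mulrA lword_starK mul1r.
by case: (s (+) t); rewrite ?mulN1r ?mul1r => /eqP;
   rewrite ?oppr_eq0 => /eqP /lword_neq0.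
Qed.

(** * Isometries map long words to signed words *)

Inductive word_span (k : nat) : leavitt2 -> Prop :=
| word_span0 : word_span k 0
| word_spanW w of (k <= size w)%N : word_span k (lword w)
| word_spanN x of word_span k x : word_span k (- x)
| word_spanD x y of word_span k x & word_span k y : word_span k (x + y).

Lemma word_span_leq k l x : (k <= l)%N -> word_span l x -> word_span k x.
Proof.
move=> kl; elim=> {x} [|w lw|x _|x y _ kx _]; first exact: word_span0.
- exact/word_spanW/(leq_trans kl).
- exact: word_spanN.
- exact: word_spanD.
Qed.

Lemma word_spanM k x v :
  word_span k x -> word_span (k + size v) (x * lword v).
Proof.
elim=> {x} [|w kw|x _|x y _ kx _].
- by rewrite mul0r; apply: word_span0.
- by rewrite -lword_cat; apply: word_spanW; rewrite size_cat leq_add2r.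
- by rewrite mulNr; apply: word_spanN.
- by rewrite mulrDl; apply: word_spanD.
Qed.

(** A starred letter cancels against the first letter of a word or kills it, so a word with enough
    letters absorbs all the starred letters of a term. *)
Lemma eventually_word_span (z : leavitt2) :
  exists n, forall u, (n <= size u)%N -> word_span 0 (z * lword u).
Proof.
elim/leavitt_ind: z; elim.
- by exists 0%N => u _; rewrite -/la -(lword_cons false); apply: word_spanW.
- exists 1%N => -[//|c u] _; rewrite lword_cons mulrA -/las.
  case: c; rewrite ?las_la ?las_lb ?mul1r ?mul0r; first exact: word_span0.
  exact: word_spanW.
- by exists 0%N => u _; rewrite -/lb -(lword_cons true); apply: word_spanW.
- exists 1%N => -[//|c u] _; rewrite lword_cons mulrA -/lbs.
  case: c; rewrite ?lbs_la ?lbs_lb ?mul1r ?mul0r; last exact: word_span0.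
  exact: word_spanW.
- by exists 0%N => u _; rewrite leavitt_pi0 mul0r; apply: word_span0.
- by exists 0%N => u _; rewrite leavitt_pi1 mul1r; apply: word_spanW.
- move=> s [n sn]; exists n => u nu.
  by rewrite leavitt_piN mulNr; apply/word_spanN/sn.
- move=> s [m sm] t [n tn]; exists (maxn m n) => u.
  rewrite geq_max leavitt_piD => /andP[mu nu].
  by rewrite mulrDl; apply: word_spanD; [apply: sm | apply: tn].
(* The first [n] letters are spent on [t]; the remaining ones, at least [m], stay at the end of
   every word produced and are available to [s]. *)
- move=> s [m sm] t [n tn]; exists (n + m)%N => u nmu.
  rewrite leavitt_piM -mulrA -[u](cat_take_drop n) lword_cat [X in _ * X]mulrA.
  have /(@word_spanM _ _ (drop n u)) :
      word_span 0 (leavitt_pi t * lword (take n u)).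
    by apply: tn; rewrite size_takel //; lia.
  rewrite size_drop => /(@word_span_leq m) -/(_ ltac:(lia)).
  elim=> [|w mw|x _|x y _ sx _].
  + by rewrite mulr0; apply: word_span0.
  + exact: sm.
  + by rewrite mulrN; apply: word_spanN.
  + by rewrite mulrDr; apply: word_spanD.
Qed.

Lemma word_span_coef x : word_span 0 x ->
  exists2 l, uniq l & x = \sum_(w <- l) lword w *~ coef w x.
Proof.
move=> span_x.
(* Allowing every larger list lets the expansions of two summands be added over a common list. *)
have [l xE] : exists l0 : seq (seq bool),
    forall l, uniq l -> {subset l0 <= l} ->
    x = \sum_(w <- l) lword w *~ coef w x; last first.
  exists (undup l); first exact: undup_uniq.
  by apply: xE => [|w]; rewrite ?undup_uniq ?mem_undup.
elim: span_x => {x} [|w _|x _ [l xE]|x y _ [l xE] _ [m yE]].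
- by exists [::] => l _ _; rewrite big1 // => w _; rewrite coef0 mulr0z.
- exists [:: w] => l ul wl.
  rewrite (bigD1_seq w) ?wl ?mem_seq1 //= coef_lword eqxx mulr1z big1 ?addr0 //.
  by move=> v /negPf vw; rewrite coef_lword vw mulr0z.
- exists l => l' ul' ll'; rewrite {1}(xE l' ul' ll') -sumrN.
  by apply: eq_bigr => w _; rewrite coefN mulrNz.
- exists (l ++ m) => l' ul' sub.
  under eq_bigr do rewrite coefD mulrzDr.
  rewrite big_split; congr (_ + _); [apply: xE | apply: yE] => // w wl.
    by apply: sub; rewrite mem_cat wl.
  by apply: sub; rewrite mem_cat wl orbT.
Qed.

Lemma sum_sqr_eq1 (I : eqType) (l : seq I) (c : I -> int) :
    \sum_(i <- l) c i ^+ 2 = 1 ->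
  exists2 i, i \in l &
    c i ^+ 2 = 1 /\ forall j, j \in l -> j != i -> c j = 0.
Proof.
elim: l => [|i l IHl]; first by rewrite big_nil.
have sum_ge0 : 0 <= \sum_(j <- l) c j ^+ 2.
  by apply: sumr_ge0 => j _; apply: sqr_ge0.
rewrite big_cons; have [ci0|ci_neq0] := eqVneq (c i) 0.
  rewrite ci0 expr0n add0r => /IHl[k kl [ck c0]].
  exists k; rewrite ?inE ?kl ?orbT //; split=> // j.
  by rewrite inE => /predU1P[->//|jl]; apply: c0.
have ci_gt0 : 0 < c i ^+ 2 by rewrite exprn_even_gt0.
move=> sum1; have [ci1 sum0] : c i ^+ 2 = 1 /\ \sum_(j <- l) c j ^+ 2 = 0.
  by move: (c i ^+ 2) (\sum_(j <- l) _) ci_gt0 sum_ge0 sum1 => x y; lia.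
exists i; rewrite ?mem_head //; split=> // j; rewrite inE => /predU1P[->|jl].
  by rewrite eqxx.
have /allP/(_ j jl) : all (fun j => true ==> (c j ^+ 2 == 0)) l.
  by rewrite -psumr_eq0 ?sum0 // => k _; apply: sqr_ge0.
by rewrite sqrf_eq0 => /eqP.
Qed.

Lemma morphD_sumMz (U V : zmodType) (g : U -> V) (I : Type) (l : seq I)
    (y : I -> U) (c : I -> int) : {morph g : x y / x + y} ->
  g (\sum_(i <- l) y i *~ c i) = \sum_(i <- l) g (y i) *~ c i.
Proof.
move=> gD.
have gB : zmod_morphism g.
  by move=> x z; apply: (addIr (g z)); rewrite -gD !subrK.
pose G : {additive U -> V} := HB.pack g (GRing.isZmodMorphism.Build U V g gB).
by rewrite -[g]/(G : U -> V) raddf_sum; apply: eq_bigr => i _; rewrite raddfMz.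
Qed.

(* The coefficient of the empty word in [star x * x] is the sum of the        *)
(* squares of the coefficients of [x].                                        *)
Lemma word_span_isometry x :
  word_span 0 x -> star x * x = 1 ->
  exists (s : bool) w, x = (-1) ^+ s * lword w.
Proof.
move=> /word_span_coef[l ul xE] xx1.
have starxE : star x = \sum_(w <- l) lword_star w *~ coef w x.
  rewrite {1}xE morphD_sumMz; last exact: starD.
  by under eq_bigr do rewrite star_lword1.
have [w wl [cw1 c0]] : exists2 w, w \in l &
    coef w x ^+ 2 = 1 /\ forall v, v \in l -> v != w -> coef v x = 0.
  apply: sum_sqr_eq1; transitivity (coef [::] 1); last first.
    by rewrite -lword_nil coef_lword.
  rewrite -xx1 starxE mulr_suml.
  under [in RHS]eq_bigr do rewrite mulrzAl.
  rewrite morphD_sumMz; last exact: coefD.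
  by apply: eq_bigr => v _; rewrite coef_lword_star -mulrzl intz.
exists (coef w x == -1), w.
rewrite {1}xE (bigD1_seq w) //= big_seq_cond big1 ?addr0.
  by move/eqP: cw1; rewrite sqrf_eq1 => /orP[]/eqP ->;
     rewrite ?mulr1z ?mul1r ?mulrN1z ?mulN1r.
by move=> v /andP[vl /(c0 _ vl) ->]; rewrite mulr0z.
Qed.

Lemma isometry_sends z : star z * z = 1 ->
  exists n, forall u, (n <= size u)%N -> exists w, sends z u w.
Proof.
move=> zz1; have [n zn] := eventually_word_span z; exists n => u nu.
have [|s [w zuE]] := word_span_isometry (zn u nu); last by exists w, s.
by rewrite starM star_lword1 -mulrA [X in _ * X]mulrA zz1 mul1r lword_starK.
Qed.

(** * Star endomorphisms as pushdown automata *)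

Lemma star_morph_ortho (F : {rmorphism leavitt2 -> leavitt2}) u v :
    star_preserving F -> size u = size v ->
  star (F (lword u)) * F (lword v) = (u == v)%:R.
Proof.
by move=> Fs uv; rewrite -Fs star_lword1 -rmorphM lword_ortho // rmorph_nat.
Qed.

Lemma star_morph_sends (F : {rmorphism leavitt2 -> leavitt2}) g :
    star_preserving F ->
  exists n, forall u, (n <= size u)%N -> exists w, sends (F (lword g)) u w.
Proof. by move=> Fs; apply: isometry_sends; rewrite star_morph_ortho ?eqxx. Qed.

Lemma star_morph_incomparable (F : {rmorphism leavitt2 -> leavitt2})
    g g' u u' v v' :
    star_preserving F -> size g = size g' ->
    (g != g') || (size u == size u') && (u != u') ->
  sends (F (lword g)) u v -> sends (F (lword g')) u' v' -> ~~ prefix v v'.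
Proof.
move=> Fs gg' ne; apply: sends_not_prefix; rewrite star_morph_ortho //.
move: ne; case: (g =P g') => [_ /andP[/eqP uu' /negPf neu]|_ _] /=.
  by rewrite mulr1 lword_ortho // neu.
by rewrite mulr0 mul0r.
Qed.

(* The letters of [g], read from right to left, lead from the stack [u] to    *)
(* the stack [w].                                                             *)
Inductive pushdown (F : leavitt2 -> leavitt2) (n L : nat) (u : seq bool) :
  seq bool -> seq bool -> Prop :=
| pushdown_nil : pushdown F n L u [::] u
| pushdown_cons c g v w z :
    size v = n -> (size w <= L)%N -> sends (F (lword [:: c])) v w ->
    pushdown F n L u g (v ++ z) -> pushdown F n L u (c :: g) (w ++ z).

Lemma pushdown_sends (F : {rmorphism leavitt2 -> leavitt2}) n L u g w :
  pushdown F n L u g w -> sends (F (lword g)) u w.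
Proof.
elim=> [|c {}g v w' z _ _ sw _ IH].
  by rewrite lword_nil rmorph1; apply: sends1.
by rewrite -cat1s lword_cat rmorphM; apply: sendsM IH (sends_cat _ sw).
Qed.

(** One depth [n] serves both letters, and [L] bounds the finitely many replacements of the words of
    length [n]. A step loses at most [n] letters, so a stack of height [n * size g] never runs
    out. *)
Lemma pushdown_exists (F : {rmorphism leavitt2 -> leavitt2}) :
    star_preserving F ->
  exists n L, (n < L)%N /\
    forall g u, (n * size g <= size u)%N -> exists w, pushdown F n L u g w.
Proof.
move=> Fs; have [n0 Fn0] := star_morph_sends [:: false] Fs.
have [n1 Fn1] := star_morph_sends [:: true] Fs.
pose n := maxn n0 n1.
have Fn c (v : n.-tuple bool) : exists w, sends (F (lword [:: c])) v w.
  by case: c; [apply: Fn1 | apply: Fn0]; rewrite size_tuple leq_max leqnn ?orbT.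
have /fin_all_exists[h hP] : forall cv : bool * n.-tuple bool,
    exists w, sends (F (lword [:: cv.1])) cv.2 w by case.
pose L := (\max_cv size (h cv) + n).+1.
exists n, L; split; first by rewrite /L; lia.
move=> g u nu.
suff [w [uw _]] : exists w,
    pushdown F n L u g w /\ (size u - n * size g <= size w)%N.
  by exists w.
elim: g nu => [|c g IHg] /= nu.
  by exists u; split; [apply: pushdown_nil | lia].
have [|w [uw szw]] := IHg; first by lia.
have vn : size (take n w) == n by rewrite size_takel //; lia.
have := hP (c, Tuple vn); set w' := h _ => /= sw'.
exists (w' ++ drop n w); split; last by rewrite size_cat size_drop; lia.
apply: pushdown_cons sw' _; rewrite ?cat_take_drop //; first exact/eqP.
rewrite /L ltnW // ltnS (leq_trans _ (leq_addr _ _)) //.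
exact: (leq_bigmax (c, Tuple vn)).
Qed.

(* Cut at the last time the stack rises above height [l]: from then on its    *)
(* bottom part [z] is never read.                                             *)
Lemma pushdown_last_rise F n L u g w l :
    pushdown F n L u g w -> (n <= l)%N -> (size u <= l < size w)%N ->
  exists g2 g1 p z v, [/\ pushdown F n L u g1 (p ++ z), pushdown F n L p g2 v,
    w = v ++ z, size z = (l - n)%N & (size p <= L)%N].
Proof.
move=> uw nl; elim: uw => [|c {}g v w' z vn w'L sw uvz IH]; first by lia.
rewrite size_cat => /andP[ul lw].
have [vzl|lvz] := leqP (size (v ++ z)) l; last first.
  have [|g2 [g1 [p [y [x [ug1 pg2 vzE yl pL]]]]]] := IH; first by rewrite ul.
  (* The last [n] letters read lie strictly inside the top part, so the bottom part stays
     untouched. *)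
  have nx : (n < size x)%N by move: lvz; rewrite vzE size_cat; lia.
  exists (c :: g2), g1, p, y, (w' ++ drop n x); split=> //.
    apply: (pushdown_cons vn) => //.
    have vE : v = take n x.
      have := congr1 (take n) vzE.
      by rewrite take_size_cat // takel_cat // ltnW.
    by rewrite vE cat_take_drop.
  have := congr1 (drop n) vzE; rewrite drop_size_cat // drop_cat nx => ->.
  by rewrite catA.
rewrite size_cat vn in vzl.
(* This last step is the rise itself: the stack is cut just above its bottom [l - n] letters. As
   [size z] is at most [l - n], the top has at most [size w'] letters, hence at most [L]. *)
pose k := (size w' + size z - (l - n))%N.
exists [::], (c :: g), (take k (w' ++ z)), (drop k (w' ++ z)).
exists (take k (w' ++ z)).
rewrite cat_take_drop; split=> //; first exact: pushdown_cons sw uvz.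
- exact: pushdown_nil.
- by rewrite size_drop size_cat; lia.
- by rewrite size_takel ?size_cat; lia.
Qed.

(** * A word that pumps itself *)

Definition pumps (F : leavitt2 -> leavitt2) (p q : seq bool) : Prop :=
  exists g z, (0 < size z)%N /\ sends (F (lword g)) p (q ++ z).

Lemma pumps_trans (F : {rmorphism leavitt2 -> leavitt2}) p q r :
  pumps F p q -> pumps F q r -> pumps F p r.
Proof.
move=> [g [z [z0 pq]]] [h [y [y0 qr]]]; exists (h ++ g), (y ++ z).
rewrite size_cat lword_cat rmorphM catA; split; first by lia.
exact: sendsM pq (sends_cat _ qr).
Qed.

(** Cutting at height [L] splits off a nonempty bottom of [L - n] letters and leaves a top started
    from a word of length at most [L], so the cut can be repeated [k] times. *)
Lemma pushdown_pumps (F : {rmorphism leavitt2 -> leavitt2}) n L k p g w :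
    (n < L)%N -> pushdown F n L p g w -> (size p <= L)%N ->
    (k * (L - n) + L < size w)%N ->
  exists s, [/\ size s = k, path (fun u v => `[< pumps F u v >]) p s &
    all (fun u => size u <= L)%N s].
Proof.
move=> nL; elim: k p g w => [|k IHk] p g w pw pL kw; first by exists [::].
have [|g2 [g1 [q [z [v [pq qv wE zE qL]]]]]] := pushdown_last_rise pw (ltnW nL).
  by rewrite pL; lia.
have [|s [sk qs sL]] := IHk q g2 v qv qL.
  by move: kw; rewrite wE size_cat zE; lia.
exists (q :: s); split; rewrite /= ?sk ?qL ?qs ?andbT //; apply/asboolP.
by exists g1, z; split; [lia | apply: pushdown_sends pq].
Qed.

Lemma size_uniq_bounded L (s : seq (seq bool)) :
  uniq s -> all (fun u => size u <= L)%N s -> (size s <= #|{bseq L of bool}|)%N.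
Proof.
move=> us /allP sL; have : size s = size (pmap insub s : seq {bseq L of bool}).
  by rewrite size_pmap_sub; apply/esym/eqP; rewrite -all_count; apply/allP.
by move=> ->; rewrite -(card_uniqP _) ?max_card // pmap_sub_uniq.
Qed.

Lemma prefix_comparable (T : eqType) (a b c : seq T) :
  prefix a c -> prefix b c -> prefix a b || prefix b a.
Proof.
wlog: a b / (size a <= size b)%N => [IH|ab /prefixP[x cE] bc].
  by case/orP: (leq_total (size a) (size b)) => ab; [|rewrite orbC];
     move=> *; apply: IH.
apply/orP; left; move: bc; rewrite cE !prefixE => /eqP <-.
by rewrite take_takel // take_size_cat.
Qed.

(* The words reached from the [2 ^ (m + K)] pairs [(g, u)] are pairwise      *)
(* incomparable, so they cannot all be shorter than [K + m].                 *)
Lemma pushdown_growth (F : {rmorphism leavitt2 -> leavitt2}) n L K m :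
    star_preserving F ->
    (forall g u, (n * size g <= size u)%N -> exists w, pushdown F n L u g w) ->
    (n * m <= K)%N ->
  exists g u w, [/\ pushdown F n L u g w, size u = K & (K + m <= size w)%N].
Proof.
move=> Fs Fn nmK.
have /fin_all_exists[h hP] : forall gu : m.-tuple bool * K.-tuple bool,
    exists w, pushdown F n L gu.2 gu.1 w.
  by move=> [g u]; apply: Fn; rewrite !size_tuple.
have [/existsP[[g u] Km]|] := boolP [exists gu, (K + m <= size (h gu))%N].
  by exists g, u, (h (g, u)); split; rewrite ?size_tuple //; apply: (hP (g, u)).
rewrite negb_exists => /forallP h_lt.
pose M := (K + m).-1.
(* Padding to the common length [M] loses nothing: two words with the same padding are prefixes of
   one word, hence comparable. *)
have szM gu : size (h gu ++ nseq (M - size (h gu)) false) == M.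
  by have := h_lt gu; rewrite size_cat size_nseq /M; lia.
have inj : injective (fun gu => Tuple (szM gu)).
  move=> [g u] [g' u'] /(congr1 val) /= hE; apply/eqP; apply: contraT => ne.
  have incomp cv cv' : cv != cv' -> ~~ prefix (h cv) (h cv').
    move=> ne_cv; apply: star_morph_incomparable (pushdown_sends (hP cv))
      (pushdown_sends (hP cv')) => //; first by rewrite !size_tuple.
    case: cv cv' ne_cv => [c v] [c' v'].
    by rewrite xpair_eqE negb_and !size_tuple eqxx.
  have := incomp _ _ ne; rewrite eq_sym in ne; have := incomp _ _ ne.
  move: hE; set a := h _; set b := h _ => hE.
  have /(prefix_comparable (prefix_prefix a (nseq (M - size a) false))) :
      prefix b (a ++ nseq (M - size a) false) by rewrite hE prefix_prefix.
  by case/orP=> ->.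
have := leq_card _ inj.
rewrite card_prod !card_tuple card_bool -expnD leq_exp2l // /M => Mle.
(* Truncated subtraction leaves the case [K + m = 0], where [h_lt] is absurd. *)
have := h_lt (nseq_tuple m false, nseq_tuple K false); lia.
Qed.

Lemma pumps_self (F : {rmorphism leavitt2 -> leavitt2}) :
  star_preserving F -> exists p, pumps F p p.
Proof.
move=> Fs; have [n [L [nL Fn]]] := pushdown_exists Fs.
pose k := #|{bseq L of bool}|.+1; pose m := (k * (L - n) + L).+1.
have [|g [u [w [uw uK mw]]]] := @pushdown_growth F n L (n * m + n) m Fs Fn.
  exact: leq_addr.
(* The starting stack [u] may exceed [L]; this first cut replaces it by a short [p] and discards
   only [n * m] letters of [w]. *)
have [||g2 [g1 [p [z [v [_ pv wE zE pL]]]]]] :=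
  pushdown_last_rise (l := n * m + n) uw.
- exact: leq_addl.
- by rewrite uK leqnn (leq_trans _ mw) // -addn1 leq_add2l.
have [|s [sk ps sL]] := pushdown_pumps (k := k) nL pv pL.
  by move: mw; rewrite wE size_cat zE /m; lia.
apply: contrapT => no_pump.
(* [pumps] is transitive, so without a self-pumping word the chain has no repetition, yet it is
   longer than the number of words of length at most [L]. *)
have /size_uniq_bounded/(_ sL) : uniq s.
  apply: sorted_uniq (path_sorted ps).
    by move=> q r t /asboolP rq /asboolP qt; apply/asboolP/(pumps_trans rq qt).
  by move=> q; apply/asboolP => qq; apply: no_pump; exists q.
by rewrite sk ltnn.
Qed.

(** * Commutation and periodic words *)

Lemma sends_comm y z u u' v v' :
    y * z = z * y -> sends z u v -> sends y u u' -> sends z u' v' ->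
  sends y v v'.
Proof.
move=> yzC [s zu] yu zu'.
have [t yzu] : sends (y * z) u v' by rewrite yzC; apply: sendsM yu zu'.
exists (s (+) t); move: yzu; rewrite -mulrA zu mulrA commr_sign -mulrA.
move=> /(congr1 ( *%R ((-1) ^+ s))).
by rewrite !mulrA -signr_addb addbb mul1r signr_addb.
Qed.

(* [z] and [z'] are prefixes of the infinite power of the last [size u]       *)
(* letters of [a].                                                            *)
Lemma cat_shift_comparable (T : eqType) (a b u z z' : seq T) :
    (0 < size u)%N -> a ++ z = (b ++ z) ++ u -> a ++ z' = (b ++ z') ++ u ->
  prefix z z' || prefix z' z.
Proof.
move=> u_gt0 az az'.
have aE : size a = (size b + size u)%N.
  by have := congr1 size az; rewrite !size_cat; lia.
pose v := drop (size b) a.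
have vE : size v = size u by rewrite size_drop aE; lia.
have nthE x y i : a ++ y = (b ++ y) ++ u -> (i < size y)%N ->
    nth x y i = nth x v (i %% size u).
  move=> ay iy; have vy : v ++ y = y ++ u.
    have := congr1 (drop (size b)) ay.
    rewrite -catA [RHS]drop_size_cat // drop_cat.
    by case: ltnP => //; rewrite aE; lia.
  (* By [v ++ y = y ++ u], letter [i] of [y] is letter [i] of [v], or else letter [i - size u] of
     [y]. *)
  elim/ltn_ind: i iy => i IHi iy.
  have := congr1 (nth x ^~ i) vy; rewrite !nth_cat iy vE => <-.
  case: ltnP => ui; first by rewrite modn_small.
  by rewrite IHi; [congr nth; rewrite -{2}(subnK ui) modnDr | lia | lia].
wlog: z z' az az' / (size z <= size z')%N => [IH|zz'].
  by case/orP: (leq_total (size z) (size z')) => ?; [|rewrite orbC]; apply: IH.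
apply/orP; left; rewrite prefixE; apply/eqP.
case: z => [|x z] in az zz' *; first exact: take0.
apply: (@eq_from_nth _ x); rewrite size_takel // => i iz.
rewrite nth_take // (nthE x _ _ az) // (nthE x _ _ az') //.
exact: leq_trans iz zz'.
Qed.

Lemma no_commuting_star_endo (F G : {rmorphism leavitt2 -> leavitt2}) :
    star_preserving F -> star_preserving G ->
  ~ (forall x y, F x * G y = G y * F x).
Proof.
move=> Fs Gs FG; have [p [d [u [u_gt0 Dp]]]] := pumps_self Fs.
have [N DN] := star_morph_sends d Fs.
pose w j := flatten (nseq j u).
have w_size j : (j <= size (w j))%N.
  by elim: j => //= j IHj; rewrite /w /= size_cat -/(w j); lia.
have wC j : u ++ w j = w j ++ u.
  by elim: j => [|j IHj]; rewrite /w /= ?cats0 // -/(w j) -catA -IHj.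
have /fin_all_exists2[h hN hP] : forall g : N.+1.-tuple bool, exists2 x,
    (N <= size x)%N & exists v,
    sends (F (lword d)) x (x ++ u) /\ sends (G (lword g)) v x.
  move=> g; have [n Gn] := star_morph_sends g Gs.
  have [|x Gx] := Gn (p ++ w n).
    by rewrite size_cat; have := w_size n; lia.
  (* Appending [w N] makes the word long enough for [DN]. Copies of [u] commute with [u], so
     [F (lword d)] appends [u] to [p ++ w n ++ w N], and by commutation to the image under
     [G (lword g)] too. *)
  exists (x ++ w N); first by rewrite size_cat; have := w_size N; lia.
  have Gv := sends_cat (w N) Gx; exists ((p ++ w n) ++ w N); split=> //.
  apply: sends_comm (FG _ _) Gv _ (sends_cat u Gv).
  have := sends_cat (w n ++ w N) Dp.
  by rewrite -!catA -wC [w n ++ u ++ w N]catA -wC -catA.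
have takeN g : size (take N (h g)) == N by rewrite size_takel.
(* There are twice as many [g] as words of length [N], so two of the [h g] share their first [N]
   letters. *)
have [/injectiveP/leq_card|] := boolP (injectiveb (fun g => Tuple (takeN g))).
  by rewrite !card_tuple card_bool leq_exp2l // ltnn.
case/injectivePn=> g [g' gg' /(congr1 val)/= hE].
have [y Dy] := DN (take N (h g)) ltac:(by rewrite size_takel).
have [v [Dg Gg]] := hP g; have [v' [Dg' Gg']] := hP g'.
have hC := sends_uniq (sends_cat _ Dy).
have cmp : prefix (drop N (h g)) (drop N (h g'))
    || prefix (drop N (h g')) (drop N (h g)).
  apply: (@cat_shift_comparable _ y (take N (h g)) u) => //.
    by apply: hC; rewrite !cat_take_drop.
  by apply: hC; rewrite hE !cat_take_drop.
have incomp (a a' : N.+1.-tuple bool) x x' : a != a' ->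
    sends (G (lword a)) x (h a) -> sends (G (lword a')) x' (h a') ->
    ~~ prefix (h a) (h a').
  move=> aa'; apply: star_morph_incomparable; rewrite ?size_tuple //.
  by rewrite val_eqE aa'.
have catE a : take N (h a) ++ drop N (h a) = h a by apply: cat_take_drop.
have ne := incomp _ _ _ _ gg' Gg Gg'; rewrite eq_sym in gg'.
have := incomp _ _ _ _ gg' Gg' Gg; move: ne.
rewrite -(catE g) -(catE g') hE !prefix_catr // !eqxx /=.
by move=> /negPf ne /negPf ne'; rewrite ne ne' in cmp.
Qed.

(** * The two tensor factors *)

Lemma tens_rmorph1 (A B : pzRingType) :
  exists F : {rmorphism A -> tensor A B}, forall x, F x = tens x 1.
Proof.
have [tensDl _] := tens_biadditive A B.
have FB : zmod_morphism (fun x : A => tens x (1 : B)).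
  by move=> x y /=; apply: (addIr (tens y 1)); rewrite -tensDl !subrK.
have FM : monoid_morphism (fun x : A => tens x (1 : B)).
  by split=> // x y; rewrite tensM mulr1.
pose F : {rmorphism A -> tensor A B} := HB.pack (fun x : A => tens x (1 : B))
  (GRing.isZmodMorphism.Build _ _ _ FB) (GRing.isMonoidMorphism.Build _ _ _ FM).
by exists F.
Qed.

Lemma tens_rmorph2 (A B : pzRingType) :
  exists F : {rmorphism B -> tensor A B}, forall y, F y = tens 1 y.
Proof.
have [_ tensDr] := tens_biadditive A B.
have FB : zmod_morphism (fun y : B => tens (1 : A) y).
  by move=> x y /=; apply: (addIr (tens 1 y)); rewrite -tensDr !subrK.
have FM : monoid_morphism (fun y : B => tens (1 : A) y).
  by split=> // x y; rewrite tensM mulr1.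
pose F : {rmorphism B -> tensor A B} := HB.pack (fun y : B => tens (1 : A) y)
  (GRing.isZmodMorphism.Build _ _ _ FB) (GRing.isMonoidMorphism.Build _ _ _ FM).
by exists F.
Qed.

Theorem theorem4p1 :
  ~ exists f : {rmorphism tensor leavitt2 leavitt2 -> leavitt2},
      injective f /\ star_preserving f.
Proof.
case=> f [_ fs]; have [i1 i1E] := tens_rmorph1 leavitt2 leavitt2.
have [i2 i2E] := tens_rmorph2 leavitt2 leavitt2.
apply: (@no_commuting_star_endo (f \o i1) (f \o i2)) => x; last 1 first.
(* Both products of [tens x 1] and [tens 1 y] equal [tens x y]. *)
- by move=> y /=; rewrite -!rmorphM i1E i2E !tensM !mul1r !mulr1.
- by rewrite /= !i1E -fs star_tens star1.
- by rewrite /= !i2E -fs star_tens star1.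
Qed.
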